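(* Given a connected, regular and loopless digraph $G$, there is a partial groupoid $\Gamma$ (with a generating set $S$) with the properties P1, P2 and P3 such that $G$ is its Cayley digraph. Conversely, given a partial groupoid $\Gamma$ with generating set $S=\{s_1,\dots,s_d\}$ and with the properties P1, P2 and P3, its Cayley digraph is a connected, regular and loopless digraph $G$, and the sets of edges $F_{s_i}=\{(u,u*s_i) : u\in\Gamma\}$ form a factorization of $G$.
   Context: A connected regular digraph consists of a (finite) set of vertices and directed edges such that the in-degree and out-degree of every vertex is a constant $d$ (the degree) and there is a directed path between any two vertices. Multiple edges are allowed. The digraph is loopless if it has no edge $(v,v)$. A factorization of a regular digraph of degree $d$ is a disjoint decomposition of its edges into $d$ sets $F_1,\dots,F_d$, each of which is a 1-factor, i.e. every vertex has exactly one in-edge and exactly one out-edge in each $F_i$. A groupoid is a finite set $\Gamma$ with a binary (not necessarily associative) product $*$. A word is a finite sequence of elements; its value is the element formed by taking products from left to right. A subset $S\subseteq\Gamma$ is a generating set if every element of $\Gamma$ is the value of some word in $S$ (the empty word, denoted $e$, is allowed and is regarded as an element of $\Gamma$). The partial groupoid of $\Gamma$ with generating set $S$ of size $d$ consists of the $d$ columns of the multiplication table corresponding to the generators, i.e. the products $u*s$ with $u\in\Gamma$, $s\in S$; products with right factor outside $S$ are immaterial. Its Cayley digraph has vertex set $\Gamma$ and a directed edge $(u,u*s)$ for each $u\in\Gamma$ and $s\in S$. The properties are: P1: the empty word $e$ is a left identity (so $e*s=s$ for $s\in S$). P2 (loopless): $x\notin x*S=\{x*s : s\in S\}$ for all $x\in\Gamma$.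 P3 (right cancellation): for $u,v\in\Gamma$ and $s\in S$, $v*s=u*s$ only if $v=u$.
   Formalization: With multiple edges the first half fails for S a subset (2 vertices, two edges each way: P1 and P2 clash); so S is a genuine subset exactly when some vertex has no parallel out-edges, and otherwise the generators are a family in which an element may repeat. *)

(* Defs.v *)
From mathcomp Require Import all_boot.

Set Implicit Arguments.
Unset Strict Implicit.
Unset Printing Implicit Defensive.

(* Edges are a type of their own, so parallel edges are allowed. *)
Record digraph := Digraph {
  vertex :> finType;
  edge : finType;
  source : edge -> vertex;
  target : edge -> vertex
}.

Section Digraph.
Variable G : digraph.

Definition adjacent : rel G :=
  fun u v => [exists a : edge G, (source a == u) && (target a == v)].

(* The digraph without vertices is not counted as connected. *)
Definition connected : Prop :=
  0 < #|G| /\ forall u v : G, connect adjacent u v.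

Definition regular (d : nat) : Prop :=
  forall v : G, #|[set a : edge G | source a == v]| = d
             /\ #|[set a : edge G | target a == v]| = d.

Definition loopless : Prop := forall a : edge G, source a <> target a.

Definition one_factor (F : {set edge G}) : Prop :=
  forall v : G, #|[set a in F | source a == v]| = 1
             /\ #|[set a in F | target a == v]| = 1.

Definition factorization (d : nat) (I : finType) (F : I -> {set edge G}) : Prop :=
  [/\ #|I| = d,
      forall i, one_factor (F i),
      forall i j, i != j -> [disjoint F i & F j]
    & \bigcup_i F i = [set: edge G] ].

Definition no_parallel_edges_from (v : G) : Prop :=
  forall a b : edge G, source a = v -> source b = v -> target a = target b -> a = b.
End Digraph.

Definition isomorphic (G H : digraph) : Prop :=
  exists (f : G -> H) (g : edge G -> edge H),
    [/\ bijective f, bijective g,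
        forall a, source (g a) = f (source a)
      & forall a, target (g a) = f (target a)].

Record groupoid := Groupoid {
  groupoid_carrier :> finType;
  mul : groupoid_carrier -> groupoid_carrier -> groupoid_carrier
}.

(* The columns of a multiplication table that belong to the generators.  The
   generators are given as a family: gen s is the element of the carrier named
   by s, and rmul u s is the entry u * s in column s.  For a set of generators
   the family is the inclusion of that set (see columns below).  Two columns may
   carry the same element: by e * s = s this is forced when every vertex of the
   Cayley digraph is the source of parallel edges. *)
Record partial_groupoid := PartialGroupoid {
  carrier :> finType;
  empty_word : carrier;
  generator : finType;
  gen : generator -> carrier;
  rmul : carrier -> generator -> carrier
}.

Definition columns (Gam : groupoid) (e : Gam) (S : {set Gam}) : partial_groupoid :=
  @PartialGroupoid Gam e {x : Gam | x \in S} val (fun u s => mul u (val s)).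

Section PartialGroupoid.
Variable Gam : partial_groupoid.

Definition value (w : seq (generator Gam)) : Gam :=
  if w is s :: w' then foldl (@rmul Gam) (gen s) w' else empty_word Gam.

Definition generating : Prop := forall x : Gam, exists w, value w = x.

Definition P1 : Prop := forall s : generator Gam, rmul (empty_word Gam) s = gen s.

Definition P2 : Prop := forall x : Gam, x \notin [set rmul x s | s : generator Gam].

Definition P3 : Prop :=
  forall (u v : Gam) (s : generator Gam), rmul v s = rmul u s -> v = u.

(* The pair (u, s) is the edge (u, u * s). *)
Definition cayley_digraph : digraph :=
  @Digraph Gam (Gam * generator Gam)%type
    (fun a => a.1) (fun a => rmul a.1 a.2).

Definition generator_factor (s : generator Gam) : {set edge cayley_digraph} :=
  [set (u, s) | u : Gam].
End PartialGroupoid.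

(* Main.v *)
Require Import Defs.
From mathcomp Require Import all_boot.

Set Implicit Arguments.
Unset Strict Implicit.
Unset Printing Implicit Defensive.

(** Choosing a partial groupoid whose Cayley digraph is G amounts to choosing a
    factorization of G: right multiplication by a generator follows the edges of
    one 1-factor.  A factorization exists because, in a digraph of degree d > 0,
    the out-neighbourhoods satisfy Hall's condition (d |S| edges leave S and at
    most d |N(S)| edges enter its neighbourhood N(S)); a 1-factor given by Hall's
    theorem is removed and the degree drops by one.  Conversely, by P3 every
    column is a permutation of a finite set, so each edge can be travelled
    backwards by iterating its generator, and generation from the empty word
    becomes strong connectivity. *)

(** * Hall's marriage theorem *)

Section Hall.
Variables X Y : finType.
Implicit Types (r : X -> {set Y}) (S : {set X}).

Definition hall_condition r : bool :=
  [forall S : {set X}, #|S| <= #|\bigcup_(x in S) r x|].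

Definition discard r x y : X -> {set Y} :=
  fun z => if z == x then r z :\ y else r z.

(** The deletion affects only unions over sets containing [x], so a violating set contains [x]; [P]
    is that set without [x]. *)
Lemma discard_violation r x y :
  hall_condition r -> ~~ hall_condition (discard r x y) ->
  exists2 P : {set X}, x \notin P
    & #|(\bigcup_(z in P) r z) :|: (r x :\ y)| <= #|P|.
Proof.
move=> /forallP hall_r /forallPn[S]; rewrite -ltnNge => ltS.
have same Q : x \notin Q ->
    \bigcup_(z in Q) discard r x y z = \bigcup_(z in Q) r z.
  move=> xQ; apply: eq_bigr => z zQ; rewrite /discard.
  by case: eqP => // zx; rewrite -zx zQ in xQ.
have xS : x \in S.
  by apply: contraLR ltS => xS; rewrite same // -leqNgt.
exists (S :\ x); first by rewrite setD11.
move: ltS; rewrite (big_setD1 x) //= same ?setD11 // setUC.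
by rewrite {1}/discard eqxx (cardsD1 x S) xS add1n ltnS.
Qed.

(* Rado's argument: of two elements of r x, one can be discarded without
   destroying Hall's condition, by submodularity of the size of a union. *)
Lemma discard_hall r x y1 y2 :
  hall_condition r -> y1 != y2 ->
  hall_condition (discard r x y1) || hall_condition (discard r x y2).
Proof.
move=> hall_r y12; apply/negPn/negP; rewrite negb_or => /andP[].
move=> /(discard_violation hall_r)[P xP leP].
move=> /(discard_violation hall_r)[Q xQ leQ].
set A := _ :|: _ in leP; set B := _ :|: _ in leQ.
(* Since [y1 != y2], the sets [r x :\ y1] and [r x :\ y2] together cover [r x]. *)
have leU : #|x |: (P :|: Q)| <= #|A :|: B|.
  apply: leq_trans (forallP hall_r _) (subset_leq_card _).
  apply/bigcupsP => z; rewrite !inE => /or3P[/eqP-> | zP | zQ].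
  - apply/subsetP => y yrx; rewrite !inE yrx !andbT.
    by case: (y =P y1) => [->|_]; rewrite ?y12 ?orbT.
  - by rewrite /A -setUA subsetU // bigcup_sup.
  - by rewrite /B setUC -setUA subsetU // bigcup_sup.
have leI : #|P :&: Q| <= #|A :&: B|.
  apply: leq_trans (forallP hall_r _) (subset_leq_card _).
  apply/bigcupsP => z; rewrite inE => /andP[zP zQ].
  by rewrite subsetI /A /B !subsetU // bigcup_sup.
(* The contradiction: [#|A| + #|B|] is at least [#|x |: (P :|: Q)| + #|P :&: Q|], which is
   [#|P| + #|Q| + 1] because [x] lies in neither set. *)
have := leq_add leP leQ; rewrite -cardsUI leqNgt => /negP[].
apply: leq_trans (leq_add leU leI).
by rewrite cardsU1 inE (negPf xP) (negPf xQ) /= add1n addSn cardsUI.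
Qed.

(** Induction on the total size of the sets: elements are discarded until every set is a
    singleton. *)
Theorem hall_marriage r :
  hall_condition r -> exists2 f : X -> Y, injective f & forall x, f x \in r x.
Proof.
have [n] := ubnP (\sum_x #|r x|); elim: n r => // n IHn r ltn hall_r.
case: (pickP (fun x => 1 < #|r x|)) => [x /card_gt1P[y1 [y2 [y1r y2r y12]]] | le1].
  suff IH y : y \in r x -> hall_condition (discard r x y) ->
      exists2 f : X -> Y, injective f & forall x, f x \in r x.
    by case/orP: (discard_hall x hall_r y12); apply: IH.
  move=> yr hall_y.
  have ltr : \sum_z #|discard r x y z| < \sum_z #|r z|.
    rewrite (bigD1 x) //= [ltnRHS](bigD1 x) //= -addSn leq_add //.
      by rewrite /discard eqxx (cardsD1 y (r x)) yr.
    by apply: leq_sum => z /negPf zx; rewrite /discard zx.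
  case: (IHn _ (leq_trans ltr ltn) hall_y) => f injf fr; exists f => // z.
  by move: (fr z); rewrite /discard; case: eqP => // _ /setD1P[].
(* Every set now has at most one element; Hall's condition on singletons makes the sets nonempty,
   and on pairs it makes them distinct. *)
have nonempty x : {y | y \in r x}.
  apply/sigW/set0Pn; rewrite -card_gt0.
  by have := forallP hall_r [set x]; rewrite big_set1 cards1.
exists (fun x => sval (nonempty x)) => [x1 x2 eqf | x]; last first.
  exact: (svalP (nonempty x)).
have singleton x : r x = [set sval (nonempty x)].
  apply/esym/eqP; rewrite eqEcard sub1set (svalP (nonempty x)) cards1 leqNgt.
  by rewrite (le1 x).
apply: contraTeq (forallP hall_r [set x1; x2]) => x12.
rewrite bigcup_setU !big_set1 (singleton x1) (singleton x2).
by rewrite eqf setUid cards1 cards2 x12.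
Qed.
End Hall.

(** * Splitting a regular digraph into 1-factors *)

Section Factorization.
Variables (V E : finType) (s t : E -> V).
Implicit Type A : {set E}.

(** Degrees are counted inside an edge set [A], so that a factor can be deleted while the edge type
    stays fixed. *)
Definition regular_on k A : Prop := forall v,
  #|[set a in A | s a == v]| = k /\ #|[set a in A | t a == v]| = k.

Lemma card_fibers (h : E -> V) k A (S : {set V}) :
  (forall v, #|[set a in A | h a == v]| = k) ->
  #|[set a in A | h a \in S]| = #|S| * k.
Proof.
move=> fib; rewrite -sum1_card (partition_big h [in S]) /=; last first.
  by move=> a; rewrite inE => /andP[].
rewrite -sum_nat_const; apply: eq_bigr => v vS.
rewrite -(fib v) -sum1_card; apply: eq_bigl => a; rewrite !inE.
by case: eqP => [->|]; rewrite ?vS ?andbT ?andbF.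
Qed.

Lemma regular_matching k A : regular_on k.+1 A ->
  exists m : V -> E,
    [/\ forall v, m v \in A, cancel m s & injective (t \o m)].
Proof.
move=> regA; pose r v := [set t a | a in A & s a == v].
have [|f injf fr] := @hall_marriage _ _ r.
  apply/forallP => S; set N := \bigcup_(v in S) r v.
  (* After multiplication by [k.+1] both sides count edges of [A]: those leaving [S] all enter
     [N]. *)
  rewrite -(leq_pmul2r (ltn0Sn k)).
  rewrite -(card_fibers S (fun v => proj1 (regA v))).
  rewrite -(card_fibers N (fun v => proj2 (regA v))).
  apply/subset_leq_card/subsetP => a; rewrite !inE => /andP[aA aS].
  rewrite aA; apply/bigcupP; exists (s a) => //.
  by apply/imsetP; exists a; rewrite // inE aA /=.
(* Hall's theorem yields only target vertices; an edge to each is chosen here, possibly among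
   parallel ones. *)
have edge_of v : {a | [&& a \in A, s a == v & t a == f v]}.
  apply: sigW; have /imsetP[a] := fr v; rewrite inE => /andP[aA sa] ->.
  by exists a; rewrite aA sa /=.
exists (fun v => sval (edge_of v)); split.
- by move=> v; have /and3P[] := svalP (edge_of v).
- by move=> v; have /and3P[_ /eqP] := svalP (edge_of v).
- move=> u v /=.
  have /and3P[_ _ /eqP->] := svalP (edge_of u).
  by have /and3P[_ _ /eqP->] := svalP (edge_of v); apply: injf.
Qed.

(** The injection [h \o m] of a finite set into itself is bijective, so exactly one deleted edge
    lies over [v]. *)
Lemma card_fiber_remove (h : E -> V) (m : V -> E) k A v :
  (forall u, m u \in A) -> injective (h \o m) ->
  #|[set a in A | h a == v]| = k.+1 ->
  #|[set a in A :\: [set m u | u : V] | h a == v]| = k.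
Proof.
move=> mA injhm; have [u hmu] : exists u, h (m u) = v.
  by have [g _ gK] := injF_bij injhm; exists (g v); apply: gK.
rewrite (cardsD1 (m u)) inE mA hmu eqxx add1n => -[<-].
congr #|pred_of_set _|; apply/setP => a; rewrite !inE.
case: (h a =P v) => [hav|]; rewrite ?andbF // !andbT; congr (_ && _).
congr negb; apply/imsetP/eqP => [[w _ aw]|->]; last by exists u.
by rewrite aw; congr m; apply: injhm; rewrite /= -aw hav hmu.
Qed.

(** [F i v] is the edge of factor [i] leaving [v]; injectivity on targets gives one entering edge
    per vertex. That the factors exhaust all edges is obtained later by counting. *)
Lemma regular_factorization k A : regular_on k A ->
  exists F : 'I_k -> V -> E,
    [/\ forall i v, F i v \in A,
        forall i, cancel (F i) s,
        forall i, injective (t \o F i)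
      & forall i j v, F i v = F j v -> i = j].
Proof.
elim: k A => [|k IHk] A regA.
  have F0 (i : 'I_0) : V -> E by case: i.
  by exists F0; split=> [] [].
have [m [mA ms injtm]] := regular_matching regA.
have injsm : injective (s \o m) by move=> u v /=; rewrite !ms.
have [|F [FA Fs injtF injF]] := IHk (A :\: [set m u | u : V]).
  by move=> v; have [sv tv] := regA v; split; apply: card_fiber_remove.
have Fm i v : F i v <> m v.
  by move=> eqFm; have := FA i v; rewrite eqFm inE imset_f.
(* Index [ord0] carries the new matching; the earlier factors are shifted by one. *)
exists (fun i => if unlift ord0 i is Some j then F j else m).
split=> [i v | i | i | i j v].
- by case: unliftP => // j _; have /setDP[] := FA j v.
- by case: unliftP.
- by case: unliftP.
- case: unliftP => [i' ->|->]; case: unliftP => [j' ->|->] //.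
  + by move=> /injF->.
  + by move=> /Fm.
  + by move=> /esym/Fm.
Qed.
End Factorization.

(** * Isomorphisms, words and paths *)

Lemma isomorphic_trans G H K :
  isomorphic G H -> isomorphic H K -> isomorphic G K.
Proof.
move=> [f1 [g1 [bf1 bg1 s1 t1]]] [f2 [g2 [bf2 bg2 s2 t2]]].
exists (f2 \o f1), (g2 \o g1); split; try exact: bij_comp.
- by move=> a /=; rewrite s2 s1.
- by move=> a /=; rewrite t2 t1.
Qed.

(** By [P1] the first letter is itself a product with the empty word, so a word can be read as a
    walk from it. *)
Lemma value_foldl (Gam : partial_groupoid) (w : seq (generator Gam)) :
  P1 Gam -> value w = foldl (@rmul Gam) (empty_word Gam) w.
Proof. by move=> p1; case: w => //= s w; rewrite p1. Qed.

Lemma connect_word (Gam : partial_groupoid) (x y : Gam) :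
  reflect (exists w, foldl (@rmul Gam) x w = y)
          (connect (@adjacent (cayley_digraph Gam)) x y).
Proof.
apply: (iffP connectP) => [[p] | [w]].
  elim: p x => [|z p IHp] x /=; first by move=> _ ->; exists [::].
  move=> /andP[/existsP[[u s] /andP[/eqP/= -> /eqP/= <-]] path_p] y_last.
  by have [w <-] := IHp _ path_p y_last; exists (s :: w).
elim: w x => [|s w IHw] x /=; first by move=> <-; exists [::].
move=> /IHw[p path_p ->]; exists (rmul x s :: p) => //=.
by rewrite path_p andbT; apply/existsP; exists (x, s); rewrite /= !eqxx.
Qed.

(** * The partial groupoid of a factorization *)

Section PartialGroupoidOfFactorization.
Variables (G : digraph) (d : nat) (F : 'I_d -> G -> edge G) (e : G).
Hypothesis connG : connected G.
Hypothesis regG : regular G d.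
Hypothesis loopG : loopless G.
Hypothesis sourceF : forall i, cancel (F i) (@source G).
Hypothesis targetF : forall i, injective (@target G \o F i).
Hypothesis disjointF : forall i j v, F i v = F j v -> i = j.

(** The base vertex [e] is arbitrary; [gen] is chosen so that [P1] holds by computation. *)
Definition factor_groupoid : partial_groupoid :=
  @PartialGroupoid G e 'I_d (fun i => target (F i e)) (fun u i => target (F i u)).

(** Sources and disjointness give injectivity; surjectivity follows because [G] has [#|G| * d]
    edges. *)
Lemma factor_edge_bij :
  bijective (fun a : G * 'I_d => F a.2 a.1).
Proof.
apply: inj_card_bij => [[u i] [v j] /= eqF|].
  have uv : u = v by rewrite -(sourceF i u) eqF sourceF.
  by rewrite -uv in eqF *; rewrite (disjointF eqF).
rewrite card_prod card_ord -[#|vertex G|]cardsT.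
rewrite -(@card_fibers _ _ (@source G) d setT) => [|v]; last first.
  by have [<- _] := regG v; apply: eq_card => a; rewrite !inE.
by apply/subset_leq_card/subsetP => a; rewrite !inE.
Qed.

Lemma cayley_factor_groupoid : isomorphic (cayley_digraph factor_groupoid) G.
Proof.
exists id, (fun a : G * 'I_d => F a.2 a.1); split=> //.
- by exists id.
- exact: factor_edge_bij.
- by case=> u i /=; rewrite sourceF.
Qed.

Lemma factor_groupoid_P2 : P2 factor_groupoid.
Proof.
move=> x; apply/imsetP => -[/= i _ xF].
by apply: (loopG (a := F i x)); rewrite sourceF.
Qed.

Lemma factor_groupoid_P3 : P3 factor_groupoid.
Proof. by move=> u v i /= /targetF. Qed.

Lemma factor_groupoid_generating : generating factor_groupoid.
Proof.
move=> x; have [_ /(_ e x) conn] := connG.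
suff /connect_word[w eq_w] :
    connect (@adjacent (cayley_digraph factor_groupoid)) e x.
  by exists w; rewrite value_foldl.
(* Each edge of [G] is some [F i w], hence comes from a Cayley edge. *)
apply: connect_sub conn => u v /existsP[a /andP[/eqP<- /eqP<-]].
have [g _ gK] := factor_edge_bij; rewrite -(gK a); case: (g a) => w i /=.
by apply: connect1; apply/existsP; exists (w, i); rewrite /= sourceF !eqxx.
Qed.
End PartialGroupoidOfFactorization.

(** * Completing the columns to a groupoid with a set of generators *)

Section InjectiveGenerators.
Variable Gam : partial_groupoid.
Hypothesis injgen : injective (@gen Gam).

(** Products with a non-generator are immaterial; [u] serves as their default value. *)
Definition mul_of_rmul (u x : Gam) : Gam :=
  if [pick s | gen s == x] is Some s then rmul u s else u.

Lemma mul_of_rmulE u s : mul_of_rmul u (gen s) = rmul u s.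
Proof.
by rewrite /mul_of_rmul; case: pickP => [s' /eqP/injgen-> | /(_ s)/eqP].
Qed.

Definition full_groupoid : groupoid := @Groupoid Gam mul_of_rmul.
Definition generator_set : {set full_groupoid} := [set gen s | s : generator Gam].
Definition full_columns : partial_groupoid :=
  @columns full_groupoid (empty_word Gam) generator_set.

Lemma generatorP (s' : generator full_columns) : exists s, val s' = gen s.
Proof. by have /imsetP[s _ ->] := valP s'; exists s. Qed.

Definition column_of (s : generator Gam) : generator full_columns :=
  exist _ (gen s) (imset_f _ (isT : s \in generator Gam)).

Lemma column_of_bij : bijective column_of.
Proof.
apply: inj_card_bij => [s1 s2 /(congr1 val)/injgen //|].
by rewrite card_sig card_imset.
Qed.

Lemma cayley_full_columns :
  isomorphic (cayley_digraph full_columns) (cayley_digraph Gam).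
Proof.
have [name columnK nameK] := column_of_bij.
exists id, (fun a : Gam * generator full_columns => (a.1, name a.2)).
split=> //; first by exists id.
- exists (fun a => (a.1, column_of a.2)) => -[u s] /=.
    by rewrite nameK.
  by rewrite columnK.
- by case=> u s /=; rewrite -{2}(nameK s) /= mul_of_rmulE.
Qed.

Lemma full_columns_P1 : P1 Gam -> P1 full_columns.
Proof.
by move=> p1 s; have [s' eqs] := generatorP s; rewrite /= eqs mul_of_rmulE p1.
Qed.

Lemma full_columns_P2 : P2 Gam -> P2 full_columns.
Proof.
move=> p2 x; apply: contra (p2 x) => /imsetP[s _ /= eqx].
have [s' eqs] := generatorP s; rewrite eqs mul_of_rmulE in eqx.
by rewrite {1}eqx imset_f.
Qed.

Lemma full_columns_P3 : P3 Gam -> P3 full_columns.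
Proof.
move=> p3 u v s; have [s' eqs] := generatorP s.
by rewrite /= eqs !mul_of_rmulE => /p3.
Qed.

Lemma full_columns_generating : generating Gam -> generating full_columns.
Proof.
move=> genG x; have [w <-] := genG x; exists (map column_of w).
case: w => //= s w; elim: w (gen s) => //= s' w IHw y.
by rewrite mul_of_rmulE IHw.
Qed.
End InjectiveGenerators.

(** * The Cayley digraph of a partial groupoid *)

Section Converse.
Variable Gam : partial_groupoid.
Hypothesis genG : generating Gam.
Hypothesis p1 : P1 Gam.
Hypothesis p2 : P2 Gam.
Hypothesis p3 : P3 Gam.

Let injcol (s : generator Gam) : injective (@rmul Gam ^~ s).
Proof. by move=> u v /p3. Qed.

Lemma cayley_connected : connected (cayley_digraph Gam).
Proof.
split; first by apply/card_gt0P; exists (empty_word Gam).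
have from_e x : connect (@adjacent (cayley_digraph Gam)) (empty_word Gam) x.
  by apply/connect_word; have [w <-] := genG x; exists w; rewrite value_foldl.
(* Column [s] is a permutation of a finite set, so iterating it from [rmul x s] returns to [x]. *)
have back x s : connect (@adjacent (cayley_digraph Gam)) (rmul x s) x.
  have : fconnect (@rmul Gam ^~ s) (rmul x s) x.
    by rewrite (fconnect_sym (@injcol s)) fconnect1.
  apply: connect_sub => u v /eqP<-; apply: connect1.
  by apply/existsP; exists (u, s); rewrite /= !eqxx.
have to_e x : connect (@adjacent (cayley_digraph Gam)) x (empty_word Gam).
  have /connect_word[w <-] := from_e x.
  elim/last_ind: w => [|w s IHw]; first exact: connect0.
  by rewrite foldl_rcons; apply: connect_trans (back _ _) IHw.
by move=> u v; apply: connect_trans (to_e u) (from_e v).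
Qed.

Lemma column_preim (s : generator Gam) v : exists u, rmul u s = v.
Proof. by have [g _ gK] := injF_bij (@injcol s); exists (g v); apply: gK. Qed.

Lemma cayley_one_factor (s : generator Gam) : one_factor (generator_factor s).
Proof.
move=> v; split; apply/eqP/cards1P.
  exists (v, s); apply/setP => -[u s']; rewrite !inE /=.
  apply/andP/eqP => [[/imsetP[w _ [-> ->]] /eqP-> //] | [-> ->]].
  by rewrite eqxx imset_f.
(* The edge entering [v] starts at the preimage of [v] under column [s]. *)
have [w wsv] := column_preim s v.
exists (w, s); apply/setP => -[u s']; rewrite !inE /=.
apply/andP/eqP => [[/imsetP[u' _ [-> ->]] /eqP] | [-> ->]].
  by rewrite -wsv => /p3->.
by rewrite wsv eqxx imset_f.
Qed.

Lemma cayley_factorization :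
  factorization #|generator Gam| (@generator_factor Gam).
Proof.
split=> // [s | s s' ss' |]; first exact: cayley_one_factor.
  rewrite disjoint_subset; apply/subsetP => a /imsetP[u _ ->].
  by apply/imsetP => -[v _ [_ eqs]]; rewrite eqs eqxx in ss'.
apply/setP => -[u s]; rewrite inE; apply/bigcupP.
by exists s => //; apply: imset_f.
Qed.

Lemma cayley_loopless : loopless (cayley_digraph Gam).
Proof.
by move=> [u s] /= eq_u; have := p2 u; rewrite {1}eq_u imset_f.
Qed.
End Converse.

(** Double counting: each edge lies in exactly one factor, and each factor has one edge leaving and
    one entering [v]. *)
Lemma factorization_regular (G : digraph) d (I : finType) (F : I -> {set edge G}) :
  factorization d F -> regular G d.
Proof.
case=> <- factF disjF coverF v.
have count (h : edge G -> G) : (forall i, #|[set a in F i | h a == v]| = 1) ->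
    #|[set a | h a == v]| = #|I|.
  move=> h1; transitivity (\sum_i #|[set a in F i | h a == v]|); last first.
    by rewrite (eq_bigr _ (fun i _ => h1 i)) sum1_card.
  rewrite -sum1_card.
  have -> : \sum_(a in [set a | h a == v]) 1
          = \sum_(a in [set a | h a == v]) \sum_i (a \in F i).
    apply: eq_bigr => a _.
    have /bigcupP[i _ aFi] : a \in \bigcup_i F i by rewrite coverF inE.
    rewrite (bigD1 i) //= aFi big1 // => j ji.
    by rewrite (disjointFl (disjF _ _ ji)).
  rewrite exchange_big; apply: eq_bigr => i _.
  rewrite -sum1_card big_mkcond [RHS]big_mkcond; apply: eq_bigr => a _.
  by rewrite !inE; case: (h a == v); case: (a \in F i).
by split; apply: count => i; have [] := factF i v.
Qed.

Theorem theorem1 :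
  (forall (G : digraph) (d : nat),
     connected G -> regular G d -> loopless G ->
     (exists Gam : partial_groupoid,
        #|generator Gam| = d /\ generating Gam /\
        P1 Gam /\ P2 Gam /\ P3 Gam /\
        isomorphic (cayley_digraph Gam) G)
     /\
     ((exists v : G, no_parallel_edges_from v) ->
      exists (Gam : groupoid) (e : Gam) (S : {set Gam}),
        #|S| = d /\ generating (columns e S) /\
        P1 (columns e S) /\ P2 (columns e S) /\ P3 (columns e S) /\
        isomorphic (cayley_digraph (columns e S)) G))
  /\
  (forall (Gam : partial_groupoid) (d : nat),
     #|generator Gam| = d -> generating Gam ->
     P1 Gam -> P2 Gam -> P3 Gam ->
     connected (cayley_digraph Gam) /\
     regular (cayley_digraph Gam) d /\
     loopless (cayley_digraph Gam) /\
     factorization d (@generator_factor Gam)).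
Proof.
split=> [G d connG regG loopG | Gam d <- genG p1 p2 p3]; last first.
  have fact := cayley_factorization p3.
  split; first exact: cayley_connected.
  split; first exact: factorization_regular fact.
  by split; first exact: cayley_loopless.
have [|F [_ sF tF disjF]] :=
  @regular_factorization _ _ (@source G) (@target G) d setT.
  move=> v; have [sv tv] := regG v.
  by split; [rewrite -[RHS]sv | rewrite -[RHS]tv];
    apply: eq_card => a; rewrite !inE.
(* The base vertex stays a parameter: any vertex serves the first claim, and one without parallel
   out-edges serves the second. *)
pose Gam := factor_groupoid F.
have Gam_gen e : generating (Gam e) by apply: factor_groupoid_generating.
have Gam2 e : P2 (Gam e) by apply: factor_groupoid_P2.
have Gam3 e : P3 (Gam e) by apply: factor_groupoid_P3.
have Gam_iso e : isomorphic (cayley_digraph (Gam e)) G.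
  exact: cayley_factor_groupoid.
split=> [|[e simple_e]].
  have [/card_gt0P[e _] _] := connG.
  by exists (Gam e); rewrite card_ord.
(* Edges of distinct factors leaving [e] are distinct, hence have distinct targets, so the [d]
   generators are distinct elements. *)
have injgen : injective (@gen (Gam e)).
  by move=> i j /= /(simple_e _ _ (sF i e) (sF j e))/disjF.
exists (full_groupoid (Gam e)), e, (generator_set (Gam e)).
split; first by rewrite card_imset // card_ord.
split; first exact: full_columns_generating.
split; first exact: full_columns_P1.
split; first exact: full_columns_P2.
split; first exact: full_columns_P3.
exact: isomorphic_trans (cayley_full_columns injgen) (Gam_iso e).
Qed.
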